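(* Let $a_{11},a_{12},a_{21},a_{22},\ell$ be integers with $|a_{12}-a_{21}|=1$ and $\ell\neq 0$, put $s=a_{12}+a_{21}$, and let $$M=\begin{pmatrix} a_{11} & a_{12} \\ a_{21} & a_{22} \end{pmatrix},\qquad M'=\begin{pmatrix} a_{11}-\ell & a_{12} \\ a_{21} & a_{22} \end{pmatrix}.$$ Assume $\gcd(a_{11},a_{12}+a_{21})=1$. Then $M$ and $M'$ are $S$-equivalent if and only if $$\ell\equiv a_{11}(1-h)\pmod{a_{12}+a_{21}}$$ for some $h\in H_s$, where $H_s\le(\mathbb{Z}/s\mathbb{Z})^{\times}$ is the subgroup $H_s=\phi_s^{-1}(\mathcal{S}^+_{s^2})$.
   Context: Here $M$ is a Seifert matrix of a genus-one knot $K$, computed from a genus-one Seifert surface viewed as a disk with two bands, and $M'$ is the Seifert matrix of the knot obtained from $K$ by adding $2\ell$ twists to the first band. $S$-equivalence: two square integral matrices are $S$-equivalent if one can be transformed into the other by a finite sequence of operations $\Lambda_1^{\pm1},\Lambda_2^{\pm1},\Lambda_3^{\pm1}$, where $\Lambda_1$ replaces $M$ by $TMT^{t}$ with $T$ an integral unimodular matrix, and $\Lambda_2,\Lambda_3$ are the enlargements $$M\mapsto\begin{pmatrix} M & u & 0 \\ 0 & 0 & 1 \\ 0 & 0 & 0 \end{pmatrix},\qquad M\mapsto\begin{pmatrix} M & 0 & 0 \\ v & 0 & 0 \\ 0 & 1 & 0 \end{pmatrix},$$ with $u$ an arbitrary integral column and $v$ an arbitrary integral row. The group $H_s$: note $s$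 is odd. For a discriminant $D$, $\mathcal{G}^+_D$ denotes the abelian group (under Gauss composition) of $SL_2(\mathbb{Z})$-equivalence classes of primitive integral binary quadratic forms of discriminant $D$ (where $ax^2+bxy+cy^2$ has discriminant $b^2-4ac$). $\mathcal{S}^+_D\le\mathcal{G}^+_D$ denotes the subgroup generated by the squares $[ax^2+xy+cy^2]^2$ of the classes of forms $ax^2+xy+cy^2$ with $a,c\in\mathbb{Z}$ and $1-4ac=D$. For $D=s^2$ with $s$ odd there is a group isomorphism $\phi_s:(\mathbb{Z}/s\mathbb{Z})^{\times}\to\mathcal{G}^+_{s^2}$, $\phi_s(a)=[ax^2+sxy]$, under which Gauss composition corresponds to multiplication of coefficients modulo $s$.
   Formalization: The condition a22 = 0 is added to the right-hand side of the equivalence: as stated, the ''if'' direction fails for a22 ≠ 0 (e.g. a11 = a12 = a22 = ℓ = 1, a21 = 0), where M and M' are never S-equivalent. *)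

(* Defs.v *)
From Stdlib Require Import Relation_Operators.
From HB Require Import structures.
From mathcomp Require Import all_boot all_order all_algebra.

Set Implicit Arguments.
Unset Strict Implicit.
Unset Printing Implicit Defensive.

Import Order.TTheory GRing.Theory Num.Theory.

Local Open Scope ring_scope.

Definition mx2 (a b c d : int) : 'M[int]_2 :=
  @block_mx int 1 1 1 1 a%:M b%:M c%:M d%:M.

(** * S-equivalence *)

Definition sqmx := {n : nat & 'M[int]_n}.

Definition sq (n : nat) (M : 'M[int]_n) : sqmx := Tagged (fun n => 'M[int]_n) M.

Definition enlarge_col (n : nat) (M : 'M[int]_n) (u : 'cV[int]_n) :
    'M[int]_(n + (1 + 1)) :=
  block_mx M (row_mx u 0) 0 (block_mx 0 1%:M 0 0).

Definition enlarge_row (n : nat) (M : 'M[int]_n) (v : 'rV[int]_n) :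
    'M[int]_(n + (1 + 1)) :=
  block_mx M 0 (col_mx v 0) (block_mx 0 0 1%:M 0).

Inductive S_move : sqmx -> sqmx -> Prop :=
| S_move_congr (n : nat) (M T : 'M[int]_n) :
    T \in unitmx -> S_move (sq M) (sq (T *m M *m T^T))
| S_move_col (n : nat) (M : 'M[int]_n) (u : 'cV[int]_n) :
    S_move (sq M) (sq (enlarge_col M u))
| S_move_row (n : nat) (M : 'M[int]_n) (v : 'rV[int]_n) :
    S_move (sq M) (sq (enlarge_row M v)).

Definition S_equivalent (m n : nat) (M : 'M[int]_m) (N : 'M[int]_n) : Prop :=
  clos_refl_sym_trans sqmx S_move (sq M) (sq N).

(** * Binary quadratic forms *)

(** [BQF a b c] is [a x^2 + b x y + c y^2]; the middle coefficient is not
    halved. *)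
Record bqf := BQF { qa : int; qb : int; qc : int }.

Definition bqf_eval (f : bqf) (x y : int) : int :=
  qa f * x ^+ 2 + qb f * x * y + qc f * y ^+ 2.

Definition disc (f : bqf) : int := qb f ^+ 2 - 4 * qa f * qc f.

Definition primitive (f : bqf) : Prop := gcdz (gcdz (qa f) (qb f)) (qc f) = 1.

Definition SL2_equiv (f g : bqf) : Prop :=
  exists p q r t : int, p * t - q * r = 1 /\
    forall x y : int, bqf_eval g x y = bqf_eval f (p * x + q * y) (r * x + t * y).

(** The group of classes of discriminant [D] is handled through
    representatives: its elements are the forms satisfying [classform D], up to
    [SL2_equiv], and its subsets are predicates stable under [SL2_equiv]. *)
Definition classform (D : int) (f : bqf) : Prop := primitive f /\ disc f = D.

(** Gauss's direct composition (Disquisitiones, art. 235) of forms of equal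
    discriminant. All six conditions on the 2x2 minors of the bilinear
    substitution are required: the usual normalization through the two leading
    coefficients alone does not fix the orientation when one of them is 0, which
    does occur for square discriminants. *)
Definition gauss_composite (D : int) (f g h : bqf) : Prop :=
  [/\ classform D f, classform D g, classform D h &
    exists p0 p1 p2 p3 q0 q1 q2 q3 : int,
    [/\ forall x y z w : int,
          bqf_eval f x y * bqf_eval g z w =
          bqf_eval h (p0 * (x * z) + p1 * (x * w) + p2 * (y * z) + p3 * (y * w))
                     (q0 * (x * z) + q1 * (x * w) + q2 * (y * z) + q3 * (y * w)),
        [/\ p0 * q1 - p1 * q0 = qa f,
            (p0 * q3 - p3 * q0) - (p1 * q2 - p2 * q1) = qb f &
            p2 * q3 - p3 * q2 = qc f] &
        [/\ p0 * q2 - p2 * q0 = qa g,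
            (p0 * q3 - p3 * q0) + (p1 * q2 - p2 * q1) = qb g &
            p1 * q3 - p3 * q1 = qc g]]].

(** The form of discriminant [D] representing the identity class, for
    [D] congruent to 0 or 1 modulo 4. *)
Definition principal (D : int) : bqf :=
  BQF 1 (D %% 2)%Z (((D %% 2)%Z ^+ 2 - D) %/ 4)%Z.

Inductive gen_subgroup (D : int) (X : bqf -> Prop) : bqf -> Prop :=
| gen_base f : classform D f -> X f -> gen_subgroup D X f
| gen_one : gen_subgroup D X (principal D)
| gen_mul f g h : gen_subgroup D X f -> gen_subgroup D X g ->
    gauss_composite D f g h -> gen_subgroup D X h
| gen_inv f g : gen_subgroup D X f ->
    gauss_composite D f g (principal D) -> gen_subgroup D X g
| gen_equiv f g : gen_subgroup D X f -> SL2_equiv f g -> gen_subgroup D X g.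

Definition is_middle_one_square (D : int) (h : bqf) : Prop :=
  exists a c : int, 1 - 4 * a * c = D /\
    gauss_composite D (BQF a 1 c) (BQF a 1 c) h.

Definition S_plus (D : int) : bqf -> Prop :=
  gen_subgroup D (is_middle_one_square D).

Definition phi (s a : int) : bqf := BQF a s 0.

(** [H s h] says that the residue class of the integer [h] belongs to [H_s].
    Integer representatives are used because ['Z_n] is not Z/n for n = 1, and
    [s] may be 1, -1 or any other negative odd number. *)
Definition H (s h : int) : Prop := coprimez h s /\ S_plus (s ^+ 2) (phi s h).

(* Main.v *)
Require Import Defs.
From Stdlib Require Import Relation_Operators.
From mathcomp Require Import all_boot all_order all_algebra.
From mathcomp Require Import zify ring.

Set Implicit Arguments.
Unset Strict Implicit.
Unset Printing Implicit Defensive.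

Import Order.TTheory GRing.Theory Num.Theory.
Local Open Scope ring_scope.

(** A Seifert matrix with nonzero determinant determines a rational form together
    with the monodromy [M^-1 M^T], and both survive S-equivalence up to a rational
    change of basis. For matrices with the same off-diagonal entries this forces
    equal determinants, hence [a22 = 0], and then a triangular change of basis
    whose entries divide powers of [a12 * a21]; it multiplies [a11] modulo
    [s = a12 + a21] by a quotient of squares of such divisors.

    Since [s ^+ 2 = 1 + 4 * a12 * a21], the forms [a x^2 + x y + c y^2] of
    discriminant [s ^+ 2] correspond to factorizations of [- a12 * a21], and their
    squares are the [phi_s]-images of quotients of squares of divisors of
    [a12 * a21]. So [H_s] is generated by the classes [q ^+ 2] with [q] a divisor
    of [a12] or of [a21]. Conversely, for such [q] an explicit enlargement to a
    4 x 4 matrix, followed by a congruence and a reduction, multiplies [a11] by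
    [q ^+ 2]. *)

(** * Proper equivalence and Gauss composition *)

Lemma bqf_ext (f g : bqf) :
  (forall x y, bqf_eval f x y = bqf_eval g x y) -> f = g.
Proof.
case: f g => [a b c] [a' b' c'] e.
have := e 1 0; have := e 0 1; have := e 1 1; rewrite /bqf_eval /= => e1 e2 e3.
by congr BQF; lia.
Qed.

Definition bqf_act (f : bqf) (p q r t : int) : bqf :=
  BQF (bqf_eval f p r)
      (2 * qa f * p * q + qb f * (p * t + q * r) + 2 * qc f * r * t)
      (bqf_eval f q t).

Lemma bqf_actE (f : bqf) (p q r t x y : int) :
  bqf_eval (bqf_act f p q r t) x y = bqf_eval f (p * x + q * y) (r * x + t * y).
Proof. by rewrite /bqf_act /bqf_eval /=; ring. Qed.

Lemma SL2_equivP (f g : bqf) :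
  SL2_equiv f g <->
  exists p q r t : int, p * t - q * r = 1 /\ g = bqf_act f p q r t.
Proof.
split=> -[p [q [r [t [det1 e]]]]]; exists p, q, r, t; split=> //.
  by apply: bqf_ext => x y; rewrite e bqf_actE.
by move=> x y; rewrite e bqf_actE.
Qed.

Lemma SL2_equiv_sym (f g : bqf) : SL2_equiv f g -> SL2_equiv g f.
Proof.
move=> [p [q [r [t [det1 e]]]]]; exists t, (- q), (- r), p; split=> [|x y].
  by rewrite -det1; ring.
rewrite e; congr bqf_eval.
  by rewrite -[LHS]mul1r -det1; ring.
by rewrite -[LHS]mul1r -det1; ring.
Qed.

Lemma SL2_equiv_trans (f g h : bqf) :
  SL2_equiv f g -> SL2_equiv g h -> SL2_equiv f h.
Proof.
move=> [p [q [r [t [det1 e]]]]] [p' [q' [r' [t' [det1' e']]]]].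
exists (p * p' + q * r'), (p * q' + q * t'), (r * p' + t * r'),
  (r * q' + t * t'); split=> [|x y].
  by rewrite -[RHS]mul1r -{1}det1 -det1'; ring.
by rewrite e' e; congr bqf_eval; ring.
Qed.

Lemma disc_SL2_equiv (f g : bqf) : SL2_equiv f g -> disc g = disc f.
Proof.
case/SL2_equivP=> p [q [r [t [det1 ->]]]].
by rewrite -[RHS]mul1r -(expr1n _ 2) -det1 /disc /bqf_act /bqf_eval /=; ring.
Qed.

Lemma primitiveP (f : bqf) :
  primitive f <->
  exists u v w : int, u * qa f + v * qb f + w * qc f = 1.
Proof.
rewrite /primitive; split=> [prf | [u [v [w e]]]].
  have [u [v]] := Bezoutz (gcdz (qa f) (qb f)) (qc f); rewrite prf => e.
  have [u' [v' e']] := Bezoutz (qa f) (qb f).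
  by exists (u * u'), (u * v'), v; rewrite -e -e'; ring.
have : (gcdz (gcdz (qa f) (qb f)) (qc f) %| 1%R)%Z.
  rewrite -e !rpredD // dvdz_mull ?dvdz_gcdr //.
    by rewrite (dvdz_trans (dvdz_gcdl _ _)) ?dvdz_gcdl.
  by rewrite (dvdz_trans (dvdz_gcdl _ _)) ?dvdz_gcdr.
by rewrite dvdz1 => /eqP/(congr1 Posz).
Qed.

Lemma primitive_SL2_equiv (f g : bqf) :
  SL2_equiv f g -> primitive f -> primitive g.
Proof.
move/SL2_equiv_sym/SL2_equivP=> [p [q [r [t [_ ->]]]]].
case/primitiveP=> u [v [w e]]; apply/primitiveP.
exists (u * p ^+ 2 + v * (2 * p * q) + w * q ^+ 2),
  (u * p * r + v * (p * t + q * r) + w * q * t),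
  (u * r ^+ 2 + v * (2 * r * t) + w * t ^+ 2).
by rewrite -[RHS]e /bqf_act /bqf_eval /=; ring.
Qed.

Lemma classform_SL2_equiv (D : int) (f g : bqf) :
  SL2_equiv f g -> classform D f -> classform D g.
Proof.
move=> fg [prf Df]; split; first exact: primitive_SL2_equiv fg prf.
by rewrite (disc_SL2_equiv fg).
Qed.

Lemma gauss_compositeC (D : int) (f g h : bqf) :
  gauss_composite D f g h -> gauss_composite D g f h.
Proof.
case=> cf cg ch.
case=> p0 [p1 [p2 [p3 [q0 [q1 [q2 [q3 [e [f1 f2 f3] [g1 g2 g3]]]]]]]]].
split=> //; exists p0, p2, p1, p3, q0, q2, q1, q3; split=> [x y z w||].
- by rewrite mulrC e; congr bqf_eval; ring.
- by split=> //; rewrite -g2; ring.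
- by split=> //; rewrite -f2; ring.
Qed.

(** A substitution in [f] mixes the coefficients of index 0 with those of index 2, and 1 with 3. The
    minors attached to [f] then transform as its coefficients do, while those attached to [g] are
    multiplied by the determinant 1. *)
Lemma gauss_composite_equivl (D : int) (f f' g h : bqf) :
  SL2_equiv f f' -> gauss_composite D f g h -> gauss_composite D f' g h.
Proof.
move=> ff' [cf cg ch].
case=> p0 [p1 [p2 [p3 [q0 [q1 [q2 [q3 [e [f1 f2 f3] [g1 g2 g3]]]]]]]]].
split=> //; first exact: classform_SL2_equiv cf.
case/SL2_equivP: ff' => p [q [r [t [det1 ->]]]].
exists (p * p0 + r * p2), (p * p1 + r * p3), (q * p0 + t * p2),
  (q * p1 + t * p3), (p * q0 + r * q2), (p * q1 + r * q3),
  (q * q0 + t * q2), (q * q1 + t * q3); split.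
- by move=> x y z w; rewrite bqf_actE e; congr bqf_eval; ring.
- by rewrite /bqf_act /bqf_eval /= -f1 -f2 -f3; split; ring.
- rewrite -[qa g]mul1r -[qb g]mul1r -[qc g]mul1r -det1 -g1 -g2 -g3.
  by split; ring.
Qed.

Lemma gauss_composite_equivr (D : int) (f g h h' : bqf) :
  SL2_equiv h h' -> gauss_composite D f g h -> gauss_composite D f g h'.
Proof.
move=> hh' [cf cg ch].
case=> p0 [p1 [p2 [p3 [q0 [q1 [q2 [q3 [e [f1 f2 f3] [g1 g2 g3]]]]]]]]].
split=> //; first exact: classform_SL2_equiv ch.
case/SL2_equiv_sym: hh' => p [q [r [t [det1 e']]]].
exists (p * p0 + q * q0), (p * p1 + q * q1), (p * p2 + q * q2),
  (p * p3 + q * q3), (r * p0 + t * q0), (r * p1 + t * q1),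
  (r * p2 + t * q2), (r * p3 + t * q3); split.
- by move=> x y z w; rewrite e e'; congr bqf_eval; ring.
- rewrite -[qa f]mul1r -[qb f]mul1r -[qc f]mul1r -det1 -f1 -f2 -f3.
  by split; ring.
- rewrite -[qa g]mul1r -[qb g]mul1r -[qc g]mul1r -det1 -g1 -g2 -g3.
  by split; ring.
Qed.

Lemma gauss_composite_equiv (D : int) (f f' g g' h h' : bqf) :
  SL2_equiv f f' -> SL2_equiv g g' -> SL2_equiv h h' ->
  gauss_composite D f g h -> gauss_composite D f' g' h'.
Proof.
move=> ff' gg' hh' /(gauss_composite_equivr hh').
move=> /(gauss_composite_equivl ff') /gauss_compositeC.
by move=> /(gauss_composite_equivl gg') /gauss_compositeC.
Qed.

(** * The classes of discriminant [s ^+ 2] *)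

Lemma mulz_eq1_sqr (p t : int) : p * t = 1 -> p * p = 1.
Proof.
move=> pt; have : (p %| 1%R)%Z by rewrite -pt dvdz_mulr.
rewrite dvdz1 => /eqP p1.
by have [->|->] : p = 1 \/ p = -1 by lia.
Qed.

(** Dividing the zero by the gcd of its coordinates keeps it a zero by homogeneity, and a Bezout
    relation completes the quotient to a matrix of determinant 1. *)
Lemma primitive_zero (a b c x y : int) :
  a * x ^+ 2 + b * x * y + c * y ^+ 2 = 0 -> (x != 0) || (y != 0) ->
  exists p r q t : int, p * t - q * r = 1 /\
    a * p ^+ 2 + b * p * r + c * r ^+ 2 = 0.
Proof.
move=> e xy0; set g := gcdz x y.
have g0 : g != 0 by rewrite gcdz_eq0 negb_and.
have [x' ex] := dvdzP (dvdz_gcdl x y); have [y' ey] := dvdzP (dvdz_gcdr x y).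
have [u [v euv]] := Bezoutz x y.
rewrite -/g in ex ey euv; move: g g0 ex ey euv => g g0 ex ey euv.
rewrite {}ex {}ey in e euv; exists x', y', (- v), u; split.
  by apply: (mulfI g0); rewrite mulr1 -[RHS]euv; ring.
by apply: (mulfI (expf_neq0 2 g0)); rewrite mulr0 -e; ring.
Qed.

Lemma classform_phi (s h : int) :
  classform (s ^+ 2) (phi s h) <-> coprimez h s.
Proof.
rewrite /classform /primitive /disc /coprimez /phi /= gcdz0 mulr0 subr0.
by split=> [[e _]|/eqP->//]; apply/eqP.
Qed.

Lemma phi_cong (s h h' : int) :
  (s %| h' - h)%Z -> SL2_equiv (phi s h) (phi s h').
Proof.
case/dvdzP=> k e; exists 1, 0, k, 1; split=> [|x y]; first by ring.
by rewrite /bqf_eval /= -[h'](subrK h) e; ring.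
Qed.

(** The form is the product of [x] and [h x + s y], so a vanishing last coefficient puts the second
    column on one of two lines. On the first, [p = t = 1] or [p = t = -1] and the leading
    coefficient moves by a multiple of [s]; the second would turn the middle coefficient into
    [- s]. *)
Lemma phi_inj (s h h' : int) :
  s != 0 -> SL2_equiv (phi s h) (phi s h') -> (s %| h' - h)%Z.
Proof.
move=> s0 /SL2_equivP[p [q [r [t [det1 []]]]]].
rewrite /bqf_eval /= !mulr0 !mul0r !addr0.
rewrite (_ : _ + _ = p * (p * h + s * r)); last by ring.
move=> e1 e2.
rewrite (_ : _ + _ = q * (q * h + s * t)); last by ring.
move=> /esym/eqP; rewrite mulf_eq0; case/orP=> /eqP e3.
  move: det1 e1 e2; rewrite e3 => det1 e1 e2.
  have pp : p * p = 1 by apply: (@mulz_eq1_sqr _ t); rewrite -det1; ring.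
  apply/dvdzP; exists (p * r); rewrite e1 mulrDr mulrA pp; ring.
have e4 : p * (q * h + s * t) = 0 by rewrite e3 mulr0.
have e5 : (p * t - q * r) * s = s by rewrite det1 mul1r.
by move/eqP: s0; lia.
Qed.

Lemma phi_one_principal (m : int) :
  SL2_equiv (phi (2 * m + 1) 1) (principal ((2 * m + 1) ^+ 2)).
Proof.
rewrite /principal.
have -> : ((2 * m + 1) ^+ 2 %% 2)%Z = 1.
  by rewrite (_ : _ ^+ 2 = (2 * m ^+ 2 + 2 * m) * 2 + 1) ?modzMDl //; ring.
have -> : (((1 : int) ^+ 2 - (2 * m + 1) ^+ 2) %/ 4)%Z = - (m * (m + 1)).
  rewrite (_ : _ - _ = - (m * (m + 1)) * 4); last by ring.
  by rewrite mulzK.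
exists 1, (- m), 0, 1; split=> [|x y]; first by ring.
by rewrite /bqf_eval /=; ring.
Qed.

(** A square discriminant gives the form a nontrivial zero. Moving it to the second basis vector
    kills the last coefficient and leaves [s] or [- s] in the middle. *)
Lemma phi_surj (s : int) (f : bqf) :
  s != 0 -> classform (s ^+ 2) f -> exists h, SL2_equiv (phi s h) f.
Proof.
move=> s0 cf.
have [p [r [q [t [det1 e]]]]] : exists p r q t : int, p * t - q * r = 1 /\
    bqf_eval f p r = 0.
  case: (eqVneq (qa f) 0) => [a0|a0].
    by exists 1, 0, 0, 1; split; rewrite // /bqf_eval a0; ring.
  (* The zero comes from the quadratic formula, [s] being a square root of the discriminant. *)
  apply: (@primitive_zero _ _ _ (s - qb f) (2 * qa f)); last first.
    by apply/orP; right; rewrite mulf_neq0.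
  rewrite (_ : _ + _ = qa f * (s ^+ 2 - disc f)); last first.
    by rewrite /disc; ring.
  by case: cf => _ ->; rewrite subrr mulr0.
pose g := bqf_act f (- q) p (- t) r.
have fg : SL2_equiv f g.
  by apply/SL2_equivP; exists (- q), p, (- t), r; split; rewrite // -det1; ring.
have cg := classform_SL2_equiv fg cf.
have ge : g = BQF (qa g) (qb g) 0 by rewrite -e.
suff [h hg] : exists h, SL2_equiv (phi s h) g.
  by exists h; apply: SL2_equiv_trans hg (SL2_equiv_sym fg).
move: (qa g) (qb g) ge cg => a b -> {g fg} [].
rewrite /primitive /disc /= mulr0 subr0 gcdz0 => ab1 /eqP.
rewrite eqf_sqr => /orP[] /eqP eb.
  by exists a; rewrite eb; exists 1, 0, 0, 1; split=> // x y;
    congr bqf_eval; ring.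
have : coprimez a s by rewrite eb gcdzN in ab1; apply/eqP.
case/coprimezP=> -[u v] /= euv.
(* Exchanging the linear factors [x] and [a x - s y] inverts the leading
   coefficient modulo [s]. *)
exists u, a, (- s), v, u; split=> [|x y]; first by rewrite -euv; ring.
rewrite /bqf_eval /= eb -[LHS]mul1r -euv; ring.
Qed.

Lemma phi_mul (s h h' : int) :
  coprimez h s -> coprimez h' s ->
  gauss_composite (s ^+ 2) (phi s h) (phi s h') (phi s (h * h')).
Proof.
move=> hs hs'; split; try by apply/classform_phi; rewrite ?coprimezMl ?hs.
(* With [X = x z] and [Y = h x w + h' y z + s y w], the product of the second linear factors is
   [h h' X + s Y]. *)
exists 1, 0, 0, 0, 0, h, h', s; split=> [x y z w||].
- by rewrite /bqf_eval /=; ring.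
- by split=> /=; ring.
- by split=> /=; ring.
Qed.

(** Since [phi s h3] splits, the product of the two forms is the product of the bilinear forms with
    coefficients [p_i] and [l_i = h3 p_i + s q_i]. Comparing coefficients and minors forces the
    first to be [x z] up to sign, and the coefficient of [x^2 z^2] then gives the congruence. *)
Lemma phi_mul_inj (s h1 h2 h3 : int) :
  s != 0 -> gauss_composite (s ^+ 2) (phi s h1) (phi s h2) (phi s h3) ->
  (s %| h3 - h1 * h2)%Z.
Proof.
move=> s0 [/classform_phi c1 /classform_phi c2 /classform_phi c3].
case=> p0 [p1 [p2 [p3 [q0 [q1 [q2 [q3 [e [/= f1 f2 f3] [/= g1 g2 g3]]]]]]]]].
have /coprimezP[[u v] /= euv] : coprimez h1 s := c1.
pose l0 := h3 * p0 + s * q0; pose l1 := h3 * p1 + s * q1.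
pose l2 := h3 * p2 + s * q2; pose l3 := h3 * p3 + s * q3.
have el x y z w : (x * (h1 * x + s * y)) * (z * (h2 * z + s * w)) =
   (p0 * (x * z) + p1 * (x * w) + p2 * (y * z) + p3 * (y * w)) *
   (l0 * (x * z) + l1 * (x * w) + l2 * (y * z) + l3 * (y * w)).
  transitivity (bqf_eval (phi s h1) x y * bqf_eval (phi s h2) z w).
    by rewrite /bqf_eval /=; ring.
  by rewrite e /bqf_eval /= /l0 /l1 /l2 /l3; ring.
have e00 : p0 * l0 = h1 * h2.
  by have := el 1 0 1 0; rewrite !(mulr0, mulr1, mul0r, mul1r, addr0, add0r).
have e11 : p1 * l1 = 0.
  by have := el 1 0 0 1; rewrite !(mulr0, mulr1, mul0r, mul1r, addr0, add0r).
have e22 : p2 * l2 = 0.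
  by have := el 0 1 1 0; rewrite !(mulr0, mulr1, mul0r, mul1r, addr0, add0r).
have e33 : p3 * l3 = 0.
  by have := el 0 1 0 1; rewrite !(mulr0, mulr1, mul0r, mul1r, addr0, add0r).
have em : p0 * l3 + p3 * l0 + p1 * l2 + p2 * l1 = s ^+ 2.
  have := el 1 1 1 1; have := el 1 (-1) 1 1; have := el 1 1 1 (-1).
  have := el 1 (-1) 1 (-1).
  by rewrite !(mulrN1, mulr1, mul1r, mulN1r, opprK); lia.
have s03 : p0 * q3 - p3 * q0 = s by lia.
have s12 : p1 * q2 - p2 * q1 = 0 by lia.
have m03 : p0 * l3 - p3 * l0 = s ^+ 2.
  by rewrite expr2 -{2}s03 /l0 /l3; ring.
have m13 : p1 * l3 = p3 * l1.
  by apply/eqP; rewrite -subr_eq0 -(mulr0 s) -g3 /l1 /l3; apply/eqP; ring.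
have m23 : p2 * l3 = p3 * l2.
  by apply/eqP; rewrite -subr_eq0 -(mulr0 s) -f3 /l2 /l3; apply/eqP; ring.
have s2 : s ^+ 2 != 0 by rewrite expf_neq0.
(* If [l3 = 0], the two bilinear factors have exchanged roles: [em] and [m03] then give [p3 * l0]
   the opposite values [s ^+ 2] and [- s ^+ 2]. *)
move/eqP: (e33); rewrite mulf_eq0; case/orP=> /eqP z3; last first.
  have p30 : p3 != 0.
    by apply: contra_neq s2 => p30; rewrite -m03 p30 z3; ring.
  have l10 : l1 = 0 by apply: (mulfI p30); rewrite -m13 z3; ring.
  have l20 : l2 = 0 by apply: (mulfI p30); rewrite -m23 z3; ring.
  by move: m03 em s2; rewrite z3 l10 l20; lia.
have pl3 : p0 * l3 = s ^+ 2 by rewrite -m03 z3; ring.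
have l30 : l3 != 0 by apply: contra_neq s2 => l30; rewrite -pl3 l30 mulr0.
have p10 : p1 = 0 by apply: (mulIf l30); rewrite m13 z3; ring.
have p20 : p2 = 0 by apply: (mulIf l30); rewrite m23 z3; ring.
have pq1 : p0 * q1 = h1 by rewrite -f1 p10; ring.
have pq3 : p0 * q3 = s by rewrite -s03 z3; ring.
have pp : p0 * p0 = 1.
  apply: (@mulz_eq1_sqr _ (u * q1 + v * q3)).
  by rewrite -euv -{1}pq1 -pq3; ring.
apply/dvdzP; exists (- p0 * q0).
by rewrite -e00 /l0 -[X in X - _]mul1r -pp; ring.
Qed.

(** * The subgroup [H] and the squares of divisors it contains *)

Lemma coprimez_cong (s h h' : int) :
  (s %| h' - h)%Z -> coprimez h s -> coprimez h' s.
Proof.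
case/dvdzP=> k e /coprimezP[[u v] /= euv]; apply/coprimezP.
exists (u, v - u * k) => /=; rewrite -euv -[h'](subrK h) e; ring.
Qed.

Lemma H_mul (s h h' : int) : H s h -> H s h' -> H s (h * h').
Proof.
move=> [ch Sh] [ch' Sh']; split; first by rewrite coprimezMl ch.
exact: gen_mul Sh Sh' (phi_mul ch ch').
Qed.

Lemma H_one (m : int) : H (2 * m + 1) 1.
Proof.
split; first by rewrite /coprimez gcd1z.
exact: gen_equiv (gen_one _ _) (SL2_equiv_sym (phi_one_principal m)).
Qed.

Lemma H_inv (m h h' : int) :
  (2 * m + 1 %| h * h' - 1)%Z -> H (2 * m + 1) h -> H (2 * m + 1) h'.
Proof.
move=> hh' [ch Sh].
have ch' : coprimez h' (2 * m + 1).
  have := @coprimez_cong (2 * m + 1) 1 (h * h') hh'.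
  by rewrite coprimezMl {1}/coprimez gcd1z => /(_ isT) /andP[].
split=> //; apply: gen_inv Sh _.
apply: gauss_composite_equivr (phi_mul ch ch').
apply: SL2_equiv_trans (phi_one_principal m).
by apply: phi_cong; rewrite -opprB rpredN.
Qed.

(** For nonzero [x], take [y = gcdz x b]: the cofactor of [x] is coprime to that of [b], hence
    divides [c]. *)
Lemma dvdz_mul_split (x b c : int) :
  (x %| b * c)%Z -> exists y z : int, [/\ x = y * z, (y %| b)%Z & (z %| c)%Z].
Proof.
case: (eqVneq x 0) => [->|x0].
  rewrite dvd0z mulf_eq0 => /orP[] /eqP->.
    by exists 0, 1; rewrite dvdzz dvd1z mul0r.
  by exists 1, 0; rewrite dvdzz dvd1z mulr0.
set g := gcdz x b => xbc.
have g0 : g != 0 by rewrite gcdz_eq0 negb_and x0.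
have [x' ex] := dvdzP (dvdz_gcdl x b); have [b' eb] := dvdzP (dvdz_gcdr x b).
exists g, x'; split; [by rewrite mulrC | exact: dvdz_gcdr |].
have cop : coprimez x' b'.
  have [u [v euv]] := Bezoutz x b; apply/coprimezP; exists (u, v) => /=.
  rewrite -/g in ex eb euv; move: g g0 ex eb euv {xbc} => g g0 ex eb euv.
  by rewrite {}ex {}eb in euv; apply: (mulfI g0); rewrite mulr1 -[RHS]euv; ring.
rewrite -(Gauss_dvdzr c cop); have [k ek] := dvdzP xbc.
apply/dvdzP; exists k; apply: (mulfI g0).
by rewrite mulrA [g * b']mulrC -eb ek {1}ex -/g; ring.
Qed.

(** Translating [x] by [- m' y], where [m = m' q], lowers the middle coefficient of the form from
    [2 m + 1] to 1, so its square is a generator. *)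
Lemma H_sqr_dvdl (m q : int) : (q %| m)%Z -> H (2 * m + 1) (q ^+ 2).
Proof.
case/dvdzP=> m' em.
have cq : coprimez q (2 * m + 1).
  by apply/coprimezP; exists (- 2 * m', 1); rewrite em /=; ring.
split; first by rewrite expr2 coprimezMl cq.
have e : SL2_equiv (phi (2 * m + 1) q) (BQF q 1 (- (m' * (m + 1)))).
  exists 1, (- m'), 0, 1; split=> [|x y]; first by ring.
  by rewrite /bqf_eval /= em; ring.
have D : 1 - 4 * q * (- (m' * (m + 1))) = (2 * m + 1) ^+ 2 by rewrite em; ring.
apply: gen_base; first by apply/classform_phi; rewrite expr2 coprimezMl cq.
exists q, (- (m' * (m + 1))); split=> //.
apply: (gauss_composite_equiv e e _ (phi_mul cq cq)).
by apply: phi_cong; rewrite expr2 subrr dvdz0.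
Qed.

(** With [m + 1 = m' q], the product [2 m' q] is [(2 m + 1) + 1], so [2 m'] inverts [q]. The form
    with leading coefficient [q] and middle coefficient 1 lies in the class of this inverse; its
    square is treated first and then inverted. *)
Lemma H_sqr_dvdr (m q : int) : (q %| m + 1)%Z -> H (2 * m + 1) (q ^+ 2).
Proof.
case/dvdzP=> m' em.
have {}em : m = m' * q - 1 by rewrite -em addrK.
have cq : coprimez (2 * m') (2 * m + 1).
  by apply/coprimezP; exists (q, -1); rewrite em /=; ring.
suff : H (2 * m + 1) ((2 * m') ^+ 2).
  by apply: H_inv; apply/dvdzP; exists (2 * m' * q + 1); rewrite em; ring.
split; first by rewrite expr2 coprimezMl cq.
have e : SL2_equiv (phi (2 * m + 1) (2 * m')) (BQF q 1 (- (m * m'))).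
  exists q, (- m), (-1), m'; split=> [|x y]; first by rewrite em; ring.
  by rewrite /bqf_eval /= em; ring.
have D : 1 - 4 * q * (- (m * m')) = (2 * m + 1) ^+ 2 by rewrite em; ring.
apply: gen_base; first by apply/classform_phi; rewrite expr2 coprimezMl cq.
exists q, (- (m * m')); split=> //.
apply: (gauss_composite_equiv e e _ (phi_mul cq cq)).
by apply: phi_cong; rewrite expr2 subrr dvdz0.
Qed.

Lemma H_sqr_dvd_exp (m x : int) (n : nat) :
  (x %| (m * (m + 1)) ^+ n)%Z -> H (2 * m + 1) (x ^+ 2).
Proof.
elim: n x => [|n IHn] x.
  rewrite expr0 dvdz1 => /eqP x1.
  have -> : x ^+ 2 = 1 by have [->|->] : x = 1 \/ x = -1 by lia.
  exact: H_one.
rewrite exprS => /dvdz_mul_split[y [z [-> yP zP]]].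
have [y1 [y2 [-> y1P y2P]]] := dvdz_mul_split yP.
rewrite !exprMn; apply: H_mul (IHn _ zP).
by apply: H_mul; [apply: H_sqr_dvdl | apply: H_sqr_dvdr].
Qed.

(** * An invariant of S-equivalence *)

Lemma trmx_enlarge_col (n : nat) (M : 'M[int]_n) (u : 'cV[int]_n) :
  (enlarge_col M u)^T = enlarge_row M^T u^T.
Proof. by rewrite /enlarge_col !tr_block_mx tr_row_mx !trmx0 trmx1. Qed.

Lemma trmx_enlarge_row (n : nat) (M : 'M[int]_n) (v : 'rV[int]_n) :
  (enlarge_row M v)^T = enlarge_col M^T v^T.
Proof. by rewrite /enlarge_row !tr_block_mx tr_col_mx !trmx0 trmx1. Qed.

Lemma mul_enlarge_col (n p : nat) (M : 'M[int]_n) (u : 'cV[int]_n)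
    (X : 'M[int]_(n, p)) (y z : 'rV[int]_p) :
  enlarge_col M u *m col_mx X (col_mx y z) =
  col_mx (M *m X + u *m y) (col_mx z 0).
Proof.
rewrite /enlarge_col !mul_block_col mul_row_col.
by rewrite !mul0mx !mul1mx !addr0 !add0r.
Qed.

Lemma mul_enlarge_row (n p : nat) (M : 'M[int]_n) (v : 'rV[int]_n)
    (X : 'M[int]_(n, p)) (y z : 'rV[int]_p) :
  enlarge_row M v *m col_mx X (col_mx y z) =
  col_mx (M *m X) (col_mx (v *m X) y).
Proof.
rewrite /enlarge_row !mul_block_col mul_col_mx add_col_mx.
by rewrite !mul0mx !mul1mx !addr0 !add0r.
Qed.

Lemma col_mx3P (n p : nat) (X : 'M[int]_(n + (1 + 1), p)) :
  exists X0 (y z : 'rV_p), X = col_mx X0 (col_mx y z).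
Proof.
exists (usubmx X), (usubmx (dsubmx X)), (dsubmx (dsubmx X)).
by rewrite !vsubmxK.
Qed.

(* [X] intertwines, over the rationals, the monodromy [M^-1 M^T] with the pencil
   of [N]; denominators are cleared by powers of the determinant. *)
Definition seifert_lift (M : 'M[int]_2) (n : nat) (N : 'M[int]_n) : Prop :=
  exists (k : nat) (X : 'M[int]_(n, 2)),
    N *m X *m (\adj M *m M^T) = \det M *: (N^T *m X) /\
    X^T *m N *m X = \det M ^+ (2 * k) *: M.

Section Lift.
Variable M : 'M[int]_2.
Hypothesis detM : \det M != 0.
(** [A] and [B] are [\det M] times the monodromy and its inverse. *)
Let A := \adj M *m M^T.
Let B := \adj (M^T) *m M.

Lemma monodromyK : A *m B = (\det M ^+ 2)%:M.
Proof.
rewrite /A /B mulmxA -(mulmxA (\adj M)) mul_mx_adj det_tr.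
by rewrite mul_mx_scalar -scalemxAl mul_adj_mx scale_scalar_mx expr2.
Qed.

Lemma monodromyKr : B *m A = (\det M ^+ 2)%:M.
Proof.
rewrite /A /B mulmxA -(mulmxA (\adj _)) mul_mx_adj.
by rewrite mul_mx_scalar -scalemxAl mul_adj_mx det_tr scale_scalar_mx expr2.
Qed.

Lemma monodromy_inj (y : 'rV[int]_2) : y *m A = 0 -> y = 0.
Proof.
move=> yA; have : y *m A *m B = 0 by rewrite yA mul0mx.
rewrite -mulmxA monodromyK mul_mx_scalar => /eqP.
by rewrite scalemx_eq0 expf_eq0 (negPf detM) => /eqP.
Qed.

Lemma seifert_lift_self : seifert_lift M M.
Proof.
exists 0%N, 1%:M; rewrite trmx1 mul1mx !mulmx1 expr0 scale1r.
by rewrite mulmxA mul_mx_adj mul_scalar_mx.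
Qed.

Lemma seifert_lift_congr (n : nat) (N T : 'M[int]_n) :
  T \in unitmx -> seifert_lift M (T *m N *m T^T) <-> seifert_lift M N.
Proof.
move=> uT; have uTt : T^T \in unitmx by rewrite unitmx_tr.
split=> -[k [X [e1 e2]]].
  exists k, (T^T *m X); split; last by rewrite trmx_mul trmxK -e2 !mulmxA.
  apply: (can_inj (mulKmx uT)); rewrite !mulmxA in e1 *; rewrite e1.
  by rewrite !trmx_mul trmxK -scalemxAr !mulmxA.
exists k, (invmx T^T *m X); split; last first.
  rewrite trmx_mul trmx_inv trmxK -!mulmxA (mulmxA T^T) mulmxV // mul1mx.
  by rewrite (mulmxA (invmx T)) mulVmx // mul1mx mulmxA.
rewrite !trmx_mul trmxK -!mulmxA !(mulKVmx uTt).
by rewrite scalemxAr -e1 !mulmxA.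
Qed.

(** The last row of the intertwining relation kills the coordinate [y], after which [z] drops out of
    the congruence. Conversely the relation prescribes [z] up to a denominator [\det M]; scaling [X]
    clears it and raises [k] by one. *)
Lemma seifert_lift_col (n : nat) (N : 'M[int]_n) (u : 'cV[int]_n) :
  seifert_lift M (enlarge_col N u) <-> seifert_lift M N.
Proof.
split=> -[k [X [e1 e2]]].
  move: e1 e2; rewrite trmx_enlarge_col.
  have [X0 [y [z ->]]] := col_mx3P X.
  rewrite mul_enlarge_row -[_ *m _ *m col_mx _ _]mulmxA mul_enlarge_col.
  rewrite !mul_col_mx !scale_col_mx.
  case/eq_col_mx=> e1 /eq_col_mx[e2 /esym].
  rewrite mul0mx => /eqP; rewrite scalemx_eq0 (negPf detM) /= => /eqP y0.
  rewrite !tr_col_mx !mul_row_col y0 !trmx0 !mul0mx !mulmx0 !addr0 => e3.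
  by exists k, X0; split; [rewrite -e1 y0 mulmx0 addr0 | rewrite -mulmxA].
exists k.+1, (col_mx (\det M *: X) (col_mx 0 (u^T *m X *m B))).
rewrite trmx_enlarge_col mul_enlarge_row.
rewrite -[_ *m _ *m col_mx _ _]mulmxA mul_enlarge_col.
rewrite !mulmx0 !addr0 !tr_col_mx !mul_row_col trmx0 mul0mx mulmx0 !addr0.
split.
  rewrite !mul_col_mx !scale_col_mx mul0mx scaler0 -/A.
  rewrite -(mulmxA _ B A) monodromyKr mul_mx_scalar.
  by rewrite -!scalemxAr -!scalemxAl e1 !scalerA -expr2.
rewrite linearZ /= -!scalemxAl -!scalemxAr mulmxA e2 !scalerA.
by rewrite -expr2 -exprD mulnS.
Qed.

(** The argument for columns applies with one change: the last row now reads [y *m A = 0], and [y]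
    vanishes because the monodromy is invertible. *)
Lemma seifert_lift_row (n : nat) (N : 'M[int]_n) (v : 'rV[int]_n) :
  seifert_lift M (enlarge_row N v) <-> seifert_lift M N.
Proof.
split=> -[k [X [e1 e2]]].
  move: e1 e2; rewrite trmx_enlarge_row.
  have [X0 [y [z ->]]] := col_mx3P X.
  rewrite -[_ *m _ *m col_mx _ _]mulmxA.
  rewrite mul_enlarge_row mul_enlarge_col !mul_col_mx !scale_col_mx.
  case/eq_col_mx=> e1 /eq_col_mx[e2]; rewrite scaler0 => /monodromy_inj y0.
  rewrite !tr_col_mx !mul_row_col y0 !trmx0 !mul0mx !mulmx0 !addr0 => e3.
  by exists k, X0; split; [rewrite e1 y0 mulmx0 addr0 | rewrite -mulmxA].
exists k.+1, (col_mx (\det M *: X) (col_mx 0 (v *m X *m A))).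
rewrite trmx_enlarge_row -[_ *m _ *m col_mx _ _]mulmxA.
rewrite mul_enlarge_row mul_enlarge_col.
rewrite !mulmx0 !addr0 !tr_col_mx !mul_row_col trmx0 mul0mx mulmx0 !addr0.
split.
  rewrite !mul_col_mx !scale_col_mx mul0mx scaler0 -/A.
  by rewrite -!scalemxAr -!scalemxAl e1.
rewrite linearZ /= -!scalemxAl -!scalemxAr mulmxA e2 !scalerA.
by rewrite -expr2 -exprD mulnS.
Qed.

Lemma seifert_lift_S_equivalent (n : nat) (N : 'M[int]_n) :
  S_equivalent M N -> seifert_lift M N.
Proof.
have step x y : S_move x y ->
    seifert_lift M (tagged x) <-> seifert_lift M (tagged y).
  case=> {x y} m.
  - by move=> N0 T uT; exact: iff_sym (seifert_lift_congr N0 uT).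
  - by move=> N0 u; exact: iff_sym (seifert_lift_col N0 u).
  - by move=> N0 v; exact: iff_sym (seifert_lift_row N0 v).
suff iter x y : clos_refl_sym_trans sqmx S_move x y ->
    seifert_lift M (tagged x) <-> seifert_lift M (tagged y).
  by move=> /iter[/(_ seifert_lift_self)].
elim=> {x y} [x y /step //|x|x y _ xy|x y z _ xy _ yz].
- exact: iff_refl.
- exact: iff_sym xy.
- exact: iff_trans xy yz.
Qed.

End Lift.

(** * Matrices of size two, and what a lift between them forces *)

Lemma mx2P (X : 'M[int]_2) : exists a b c d, X = mx2 a b c d.
Proof.
exists (ulsubmx (X : 'M_(1 + 1)) 0 0), (ursubmx (X : 'M_(1 + 1)) 0 0),
  (dlsubmx (X : 'M_(1 + 1)) 0 0), (drsubmx (X : 'M_(1 + 1)) 0 0).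
by rewrite /mx2 -!mx11_scalar submxK.
Qed.

Lemma mx2_inj (a b c d a' b' c' d' : int) :
  mx2 a b c d = mx2 a' b' c' d' -> [/\ a = a', b = b', c = c' & d = d'].
Proof.
have inj (x y : int) : x%:M = y%:M :> 'M_1 -> x = y.
  by move=> /matrixP/(_ 0 0); rewrite !mxE !mulr1n.
by move=> /(@eq_block_mx _ 1 1 1 1)[] /inj-> /inj-> /inj-> /inj->.
Qed.

Lemma mul_mx2 (a b c d a' b' c' d' : int) :
  mx2 a b c d *m mx2 a' b' c' d' =
  mx2 (a * a' + b * c') (a * b' + b * d') (c * a' + d * c') (c * b' + d * d').
Proof. by rewrite /mx2 (@mulmx_block _ 1 1 1 1 1 1) -!scalar_mxM -!raddfD. Qed.

Lemma tr_mx2 (a b c d : int) : (mx2 a b c d)^T = mx2 a c b d.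
Proof. by rewrite /mx2 (@tr_block_mx _ 1 1 1 1) !tr_scalar_mx. Qed.

Lemma scale_mx2 (k a b c d : int) :
  k *: mx2 a b c d = mx2 (k * a) (k * b) (k * c) (k * d).
Proof. by rewrite /mx2 (@scale_block_mx _ 1 1 1 1) !scale_scalar_mx. Qed.

Lemma mx2E (a b c d : int) :
  mx2 a b c d = \matrix_(i, j) if i == 0 then if j == 0 then a else b
                              else if j == 0 then c else d.
Proof.
apply/matrixP=> i j; rewrite /mx2 !mxE; case: splitP => i' ei; rewrite !mxE;
  case: splitP => j' ej; rewrite !mxE -!val_eqE /= ?ei ?ej !ord1 //=.
Qed.

Lemma det_mx2 (a b c d : int) : \det (mx2 a b c d) = a * d - b * c.
Proof.
rewrite mx2E (expand_det_row _ 0) !big_ord_recl big_ord0 /cofactor !det_mx11.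
by rewrite !mxE /=; ring.
Qed.

Lemma adj_mx2 (a b c d : int) : \adj (mx2 a b c d) = mx2 d (- b) (- c) a.
Proof.
apply/matrixP=> i j; rewrite mx2E [in RHS]mx2E !mxE /cofactor det_mx11 !mxE.
by case: i j => [[|[|//]] i2] [[|[|//]] j2] /=; ring.
Qed.

(** Congruence by [X] multiplies the skew part of a 2 x 2 matrix by [\det X]. Both skew parts are
    given by [b - c], so [\det X] equals the scaling factor, and determinants can be compared. *)
Lemma seifert_lift_det (a b c d a' d' : int) :
  b != c -> \det (mx2 a b c d) != 0 ->
  seifert_lift (mx2 a b c d) (mx2 a' b c d') ->
  \det (mx2 a' b c d') = \det (mx2 a b c d).
Proof.
move=> bc; set D := \det (mx2 a b c d) => D0 [k [X [_ e]]].
have detX : \det X = D ^+ (2 * k).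
  have [x [y [z [w eX]]]] := mx2P X; move: e; rewrite eX.
  rewrite tr_mx2 !mul_mx2 scale_mx2 => /mx2_inj[_ e01 e10 _].
  have bc0 : b - c != 0 by rewrite subr_eq0.
  by apply: (mulIf bc0); rewrite [RHS]mulrBr -e01 -e10 det_mx2; ring.
have := congr1 determinant e; rewrite !det_mulmx det_tr detZ detX => e'.
apply: (mulfI (expf_neq0 2 (expf_neq0 (2 * k) D0))); rewrite -e' -/D; ring.
Qed.

Lemma seifert_lift_metabolic (a a' b c : int) (k : nat) (X : 'M[int]_2) :
  c - b != 0 -> c + b != 0 -> b * c != 0 ->
  let M := mx2 a b c 0 in let M' := mx2 a' b c 0 in
  M' *m X *m (\adj M *m M^T) = \det M *: (M'^T *m X) ->
  X^T *m M' *m X = \det M ^+ (2 * k) *: M ->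
  exists x, (x %| (b * c) ^+ (2 * k))%Z /\
    (b + c %| x ^+ 2 * a' - (b * c) ^+ (2 * k) * a)%Z.
Proof.
move=> cb0 s0 bc0 M M'; rewrite /M /M' det_mx2 mulr0 sub0r adj_mx2.
have [x [y [z [w ->]]]] := mx2P X.
rewrite !tr_mx2 !mul_mx2 !scale_mx2 => /mx2_inj[_ _ _ e] /mx2_inj[e00 e01 _ _].
have b0 : b != 0 by apply: contra_neq bc0 => ->; rewrite mul0r.
have c0 : c != 0 by apply: contra_neq bc0 => ->; rewrite mulr0.
(* The second basis vector is an eigenvector of both monodromies for [c / b]. The other eigenvalue
   [b / c] differs because [b ^+ 2] and [c ^+ 2] do, so [X] preserves this line. *)
have y0 : y = 0.
  apply: (mulfI (mulf_neq0 c0 (mulf_neq0 cb0 s0))).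
  by rewrite mulr0; move: e; lia.
move: e00 e01; rewrite y0 !(exprM _ 2) sqrrN -exprM => e00 e01.
exists x; split.
  by apply/dvdzP; exists w; apply: (mulIf b0); rewrite -e01; ring.
by apply/dvdzP; exists (- (x * z)); rewrite -e00; ring.
Qed.

(** * Realizing the twists *)

(** Transposition exchanges the two enlargements. This reduces divisors of [b] to divisors of
    [c]. *)
Lemma S_equivalent_trmx (m n : nat) (M : 'M[int]_m) (N : 'M[int]_n) :
  S_equivalent M N -> S_equivalent M^T N^T.
Proof.
pose tr (x : sqmx) := sq (tagged x)^T.
have step x y : S_move x y -> S_move (tr x) (tr y).
  case=> {x y} k.
  - move=> M0 T uT; rewrite /tr /= !trmx_mul trmxK mulmxA.
    exact: S_move_congr.
  - by move=> M0 u; rewrite /tr /= trmx_enlarge_col; exact: S_move_row.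
  - by move=> M0 v; rewrite /tr /= trmx_enlarge_row; exact: S_move_col.
suff iter x y : clos_refl_sym_trans sqmx S_move x y ->
    clos_refl_sym_trans sqmx S_move (tr x) (tr y) by move/iter.
elim=> {x y} [x y /step xy|x|x y _ xy|x y z _ xy _ yz].
- exact: rst_step.
- exact: rst_refl.
- exact: rst_sym.
- exact: rst_trans xy yz.
Qed.

Lemma add_mx2 (a b c d a' b' c' d' : int) :
  mx2 a b c d + mx2 a' b' c' d' = mx2 (a + a') (b + b') (c + c') (d + d').
Proof. by rewrite /mx2 (@add_block_mx _ 1 1 1 1) -!raddfD. Qed.

Lemma enlarge_row_mx2 (a b c d v w : int) :
  enlarge_row (mx2 a b c d) (row_mx v%:M w%:M : 'rV_(1 + 1)) =
  @block_mx _ 2 2 2 2 (mx2 a b c d) (mx2 0 0 0 0) (mx2 v w 0 0) (mx2 0 0 1 0).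
Proof.
rewrite /enlarge_row /mx2 !raddf0; congr (@block_mx _ 2 2 2 2 _ _ _ _).
  by rewrite (@block_mx0 _ 1 1 1 1).
by rewrite (@block_mxEv _ 1 1 1 1) row_mx0.
Qed.

Lemma enlarge_col_mx2 (a b c d u w : int) :
  enlarge_col (mx2 a b c d) (col_mx u%:M w%:M : 'cV_(1 + 1)) =
  @block_mx _ 2 2 2 2 (mx2 a b c d) (mx2 u 0 w 0) (mx2 0 0 0 0) (mx2 0 1 0 0).
Proof.
rewrite /enlarge_col /mx2 !raddf0; congr (@block_mx _ 2 2 2 2 _ _ _ _).
  by rewrite (@block_mxEh _ 1 1 1 1) col_mx0.
by rewrite (@block_mx0 _ 1 1 1 1).
Qed.

Lemma S_equivalent_shear (a b c k : int) :
  S_equivalent (mx2 a b c 0) (mx2 (a + k * (b + c)) b c 0).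
Proof.
pose T := mx2 1 k 0 1.
have uT : T \in unitmx by rewrite unitmxE det_mx2 mulr0 subr0 mulr1 unitr1.
have -> : mx2 (a + k * (b + c)) b c 0 = T *m mx2 a b c 0 *m T^T.
  by rewrite tr_mx2 !mul_mx2; congr mx2; ring.
exact/rst_step/S_move_congr.
Qed.

(** The enlargement is of row type and the reduction that follows is of column type; the Bezout
    relation makes the congruence between them unimodular. *)
Lemma S_equivalent_sqr (a b q k r t : int) :
  b * r + q * t = 1 ->
  S_equivalent (mx2 a b (q * k) 0) (mx2 (q ^+ 2 * a) b (q * k) 0).
Proof.
move=> e1.
(* The rows of [T] are a basis of the form enlarged by [(- k, 0)]. The last one,
   [e2 + q e3], is left orthogonal to everything because [k] cancels. *)
pose T := @block_mx int 2 2 2 2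
  (mx2 q (- (r * q * a)) 0 t) (mx2 (- (r * q ^+ 2 * a)) (- b) (t * q - 1) 0)
  (mx2 r (- (r ^+ 2 * a)) 0 1) (mx2 (- (r ^+ 2 * a * q)) t q 0).
(* [T'] is the inverse of [T], by virtue of [b * r + q * t = 1]. *)
pose T' := @block_mx int 2 2 2 2
  (mx2 t 0 0 q) (mx2 b (r * a) 0 (1 - q * t))
  (mx2 0 (-1) (- r) 0) (mx2 0 t q 0).
have e x : x * (b * r + q * t) = x by rewrite e1 mulr1.
have uT : T \in unitmx.
  suff /mulmx1_unit[] : T *m T' = 1%:M by [].
  rewrite mulmx_block !mul_mx2 !add_mx2 (@scalar_mx_block _ 2 2).
  have -> : 1%:M = mx2 1 0 0 1.
    by rewrite /mx2 (@scalar_mx_block _ 1 1) !raddf0.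
  have -> : 0 = mx2 0 0 0 0 by rewrite /mx2 raddf0 (@block_mx0 _ 1 1 1 1).
  by congr block_mx; congr mx2; first [ring | lia].
pose v : 'rV[int]_(1 + 1) := row_mx (- k)%:M 0%:M.
apply: rst_trans (rst_step _ _ _ _ (S_move_row _ v)) _.
apply: rst_trans (rst_step _ _ _ _ (S_move_congr _ uT)) _.
apply: rst_sym; apply: rst_step.
suff -> : T *m enlarge_row (mx2 a b (q * k) 0) v *m T^T =
  enlarge_col (mx2 (q ^+ 2 * a) b (q * k) 0)
    (col_mx (q * r * a)%:M (k * r)%:M : 'cV_(1 + 1)) by exact: S_move_col.
rewrite enlarge_row_mx2 enlarge_col_mx2 tr_block_mx !tr_mx2.
rewrite !mulmx_block !mul_mx2 !add_mx2 !mul_mx2 !add_mx2.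
(* [lia] takes nonlinear monomials as atoms, so the needed multiples of the Bezout relation are
   supplied. *)
have := (e (r * q * a), e t, e (r ^+ 2 * a)) => -[[ex1 ex2] ex3].
by congr block_mx; congr mx2; first [ring | lia].
Qed.

(** Quantifying over every corner entry [a] lets these relations be chained, so that the admissible
    [h] are closed under products and inverses modulo [b + c]. *)
Definition twistable (b c h : int) : Prop :=
  forall a a' : int, (b + c %| a' - h * a)%Z ->
    S_equivalent (mx2 a b c 0) (mx2 a' b c 0).

Lemma twistable_cong (b c h h' : int) :
  (b + c %| h' - h)%Z -> twistable b c h -> twistable b c h'.
Proof.
move=> hh' th a a' aa'; apply: th.
rewrite (_ : _ - _ = (a' - h' * a) + (h' - h) * a); last by ring.
by rewrite rpredD // dvdz_mulr.
Qed.

Lemma twistable_one (b c : int) : twistable b c 1.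
Proof.
move=> a a' /dvdzP[k]; rewrite mul1r => e.
by rewrite -(subrK a a') e addrC; exact: S_equivalent_shear.
Qed.

Lemma twistable_mul (b c h h' : int) :
  twistable b c h -> twistable b c h' -> twistable b c (h * h').
Proof.
move=> th th' a a' aa'; apply: rst_trans (th' a (h' * a) _) (th _ _ _).
  by rewrite subrr dvdz0.
by rewrite mulrA.
Qed.

Lemma twistable_inv (b c h h' : int) :
  (b + c %| h * h' - 1)%Z -> twistable b c h -> twistable b c h'.
Proof.
move=> hh' th a a' aa'; apply/rst_sym/th.
rewrite (_ : _ - _ = - ((h * h' - 1) * a + h * (a' - h' * a))); last by ring.
by rewrite rpredN; apply: rpredD; [exact: dvdz_mulr | exact: dvdz_mull].
Qed.

Lemma twistable_sqr_dvdr (b c q : int) :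
  coprimez b c -> (q %| c)%Z -> twistable b c (q ^+ 2).
Proof.
move=> bc /dvdzP[k ec] a a' aa'.
have [[r t] /= ert] := coprimezP _ _ bc.
have e1 : b * r + q * (t * k) = 1 by rewrite -ert ec; ring.
apply: (@rst_trans _ _ _ (sq (mx2 (q ^+ 2 * a) b c 0))).
  by rewrite ec mulrC; exact: S_equivalent_sqr e1.
by apply: twistable_one; rewrite mul1r.
Qed.

Lemma twistable_tr (b c h : int) : twistable b c h -> twistable c b h.
Proof.
move=> th a a'; rewrite [c + b]addrC => aa'.
have /S_equivalent_trmx := th a a' aa'.
by rewrite !tr_mx2.
Qed.

Lemma twistable_sqr (b c x : int) :
  coprimez b c -> (x %| b * c)%Z -> twistable b c (x ^+ 2).
Proof.
move=> bc /dvdz_mul_split[y [z [-> yb zc]]].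
rewrite exprMn; apply: twistable_mul; last exact: twistable_sqr_dvdr.
by apply/twistable_tr/twistable_sqr_dvdr; rewrite // coprimez_sym.
Qed.

(** The induction follows the generation of the subgroup: [phi_surj] turns each class into a residue
    and [phi_mul_inj] turns each composition into a congruence. *)
Lemma twistable_S_plus (b c : int) (f : bqf) :
  (b - c) ^+ 2 = 1 -> b + c != 0 -> S_plus ((b + c) ^+ 2) f ->
  forall h, SL2_equiv (phi (b + c) h) f -> twistable b c h.
Proof.
move=> bc1 s0.
have b1 : b - c = 1 \/ b - c = -1.
  by move/eqP: bc1; rewrite sqrf_eq1 => /orP[]/eqP; [left | right].
have [m em] : exists m, b + c = 2 * m + 1.
  by case: b1 => e; [exists c | exists b]; lia.
have cop : coprimez b c.
  by apply/coprimezP; exists (b - c, c - b); rewrite -bc1 /=; ring.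
elim=> {f} [f _ [x [y [exy /[dup] cmp [cf _ _ _]]]]||f g k Sf IHf _ IHg cmp|
  f g Sf IHf cmp|f g _ IH fg] h hf.
- have [h1 h1f] := phi_surj s0 cf.
  have hh1 : (b + c %| h - h1 * h1)%Z.
    apply: phi_mul_inj s0 (gauss_composite_equiv _ _ (SL2_equiv_sym hf) cmp);
      exact: SL2_equiv_sym.
  case/SL2_equivP: h1f => p [q [r [t [_ []]]]] ex _ _.
  (* Modulo [b + c], [h1] times the factor [p] of [x] is the other factor, and [x * y = - (b * c)]
     makes both divide [b * c]. Division by [p] is avoided by moving both matrices to the corner
     [p ^+ 2 * a']. *)
  have {}ex : x = p * (h1 * p + (b + c) * r) by rewrite ex /bqf_eval /=; ring.
  have xbc : (x %| b * c)%Z by apply/dvdzP; exists (- y); lia.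
  have tp : twistable b c (p ^+ 2).
    by apply: twistable_sqr cop (dvdz_trans _ xbc); rewrite ex dvdz_mulr.
  have tw : twistable b c ((h1 * p + (b + c) * r) ^+ 2).
    by apply: twistable_sqr cop (dvdz_trans _ xbc); rewrite ex dvdz_mull.
  move=> a a' aa'.
  have ta' : S_equivalent (mx2 a' b c 0) (mx2 (p ^+ 2 * a') b c 0).
    by apply: tp; rewrite subrr dvdz0.
  apply: rst_trans (rst_sym _ _ _ _ ta'); apply: tw.
  rewrite (_ : _ - _ = p ^+ 2 * (a' - h * a) + p ^+ 2 * a * (h - h1 * h1) -
    (b + c) * (a * (2 * h1 * p * r + (b + c) * r ^+ 2))); last by ring.
  by apply: rpredB; [apply: rpredD; exact: dvdz_mull | exact: dvdz_mulr].
- apply: (twistable_cong _ (@twistable_one b c)); rewrite em in hf s0 *.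
  exact: phi_inj s0 (SL2_equiv_trans (phi_one_principal m) (SL2_equiv_sym hf)).
- case: (cmp) => cf cg _ _.
  have [h1 h1f] := phi_surj s0 cf; have [h2 h2g] := phi_surj s0 cg.
  apply: (twistable_cong _ (twistable_mul (IHf _ h1f) (IHg _ h2g))).
  apply: phi_mul_inj s0 (gauss_composite_equiv _ _ (SL2_equiv_sym hf) cmp);
    exact: SL2_equiv_sym.
- case: (cmp) => cf _ _ _; have [h1 h1f] := phi_surj s0 cf.
  apply: (twistable_inv _ (IHf _ h1f)); rewrite -opprB rpredN.
  apply: phi_mul_inj s0 (gauss_composite_equiv (SL2_equiv_sym h1f)
    (SL2_equiv_sym hf) _ cmp).
  by rewrite em; exact/SL2_equiv_sym/phi_one_principal.
- exact: IH (SL2_equiv_trans hf (SL2_equiv_sym fg)).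
Qed.

(** * The congruence criterion for twisting the first band *)

Theorem theorem2p3 (a11 a12 a21 a22 l s : int)
  (hdiff : `|a12 - a21| = 1) (hl : l <> 0) (hs : s = a12 + a21)
  (hgcd : gcdz a11 (a12 + a21) = 1) :
  S_equivalent (mx2 a11 a12 a21 a22) (mx2 (a11 - l) a12 a21 a22) <->
  a22 = 0 /\
  exists h : int, H s h /\ (l = a11 * (1 - h) %[mod a12 + a21])%Z.
Proof.
move: hdiff hs {hgcd} => b1 ->.
move: a11 a12 a21 a22 b1 => a b c d b1.
have {}b1 : b - c = 1 \/ b - c = -1 by lia.
have bc1 : (b - c) ^+ 2 = 1 by case: b1 => ->.
have bc_neq : b != c by apply/eqP => bc; move: b1; rewrite bc subrr; lia.
(* [b] and [c] are consecutive integers, and [m] is the smaller one. *)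
have [m [em emm]] : exists m, b + c = 2 * m + 1 /\ b * c = m * (m + 1).
  case: b1 => e.
    by exists c; rewrite (_ : b = c + 1); [split; ring | lia].
  by exists b; rewrite (_ : c = b + 1); [split; ring | lia].
have s0 : b + c != 0 by apply/eqP; lia.
split=> [MM' | [-> [h [[_ Sh] /eqP]]]]; last first.
  rewrite eqz_mod_dvd => lh.
  apply: (twistable_S_plus bc1 s0 Sh).
    by exists 1, 0, 0, 1; split=> [|x y]; [ring | congr bqf_eval; ring].
  rewrite (_ : _ - _ = - (l - a * (1 - h))); last by ring.
  by rewrite rpredN.
(* The two determinants differ by [l * d], and [l] is nonzero. *)
have d0 : d = 0.
  suff dd : \det (mx2 (a - l) b c d) = \det (mx2 a b c d).
    by move: dd; rewrite !det_mx2 => dd; apply: (mulfI (introN eqP hl)); lia.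
  have M'M := rst_sym _ _ _ _ MM'.
  (* A lift has to start from a nonsingular matrix. If only the second matrix is nonsingular,
     lifting in the other direction gives a contradiction. *)
  case: (eqVneq (\det (mx2 a b c d)) 0) => D0; last first.
    exact: seifert_lift_det bc_neq D0 (seifert_lift_S_equivalent D0 MM').
  rewrite D0; apply/eqP/negPn/negP => D1; move/eqP: (D1); apply.
  have lift := seifert_lift_S_equivalent D1 M'M.
  by rewrite -D0 (seifert_lift_det bc_neq D1 lift).
(* When [b * c = 0], the modulus is 1 or -1 and the congruence holds trivially. *)
split=> //; case: (eqVneq (b * c) 0) => bc0.
  exists 1; split; first by rewrite em; exact: H_one.
  apply/eqP; rewrite eqz_mod_dvd subrr mulr0 subr0.
  have : b + c = 1 \/ b + c = -1.
    have : (b + c) ^+ 2 == 1.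
      by apply/eqP; rewrite -bc1 -[LHS]subr0 -(mulr0 4) -bc0; ring.
    by rewrite sqrf_eq1 => /orP[]/eqP; [left | right].
  by case=> ->; [exact: dvd1z | apply/dvdzP; exists (- l); ring].
have D0 : \det (mx2 a b c d) != 0.
  by rewrite det_mx2 d0 mulr0 sub0r oppr_eq0.
have [k [X [e1 e2]]] := seifert_lift_S_equivalent D0 MM'.
have cb0 : c - b != 0 by rewrite subr_eq0 eq_sym.
have cb1 : c + b != 0 by rewrite addrC.
rewrite d0 in e1 e2.
have [x [xdvd e]] := seifert_lift_metabolic cb0 cb1 bc0 e1 e2.
have Hx : H (b + c) (x ^+ 2).
  by rewrite emm in xdvd; rewrite em; exact: H_sqr_dvd_exp xdvd.
have Hbc : H (b + c) ((b * c) ^+ (2 * k)).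
  rewrite mulnC exprM em; apply: (@H_sqr_dvd_exp _ _ k).
  by rewrite -emm dvdzz.
have [[y w] /= eyw] := coprimezP _ _ (proj1 Hx).
have Hy : H (b + c) y.
  rewrite em in Hx *; apply: (H_inv _ Hx); apply/dvdzP; exists (- w).
  by rewrite -em -eyw; ring.
(* The lift gives [x ^+ 2 * (a - l)] congruent to [(b * c) ^+ (2 * k) * a], and [y] inverts [x ^+ 2]
   modulo [b + c]. *)
exists (y * (b * c) ^+ (2 * k)); split; first exact: H_mul.
apply/eqP; rewrite eqz_mod_dvd.
have [j ej] := dvdzP e.
apply/dvdzP; exists (w * (l - a) - y * j).
move: (x ^+ 2) ((b * c) ^+ _) ej eyw => z E ej eyw.
apply: subr0_eq; transitivity ((l - a) * (1 - (y * z + w * (b + c))) -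
  y * (z * (a - l) - E * a - j * (b + c))); first by ring.
by rewrite eyw ej !subrr !mulr0 subrr.
Qed.
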